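(* Let $g_1,\ldots,g_r\in\mathbb{R}[x_1,\ldots,x_n]$ be such that $X=\{x\in\mathbb{R}^n: g_1(x)\ge 0,\ldots,g_r(x)\ge 0\}$ is compact, and let $R>0$ be such that $g_0(x)=R^2-|x|^2$ is nonnegative on $X$. If $f\in\mathbb{R}[x_1,\ldots,x_n]$ is strictly positive on $X$, then there exist $\sigma_0,\sigma_1\in\sum\mathbb{R}[x]^2$ and $\varphi\in\sum\mathbb{R}[t]^2$ such that $$f=\sigma_0+\sigma_1g_0+\sum_{i=1}^r\varphi(g_i)g_i .$$
   Context: $|x|^2=x_1^2+\cdots+x_n^2$. $\sum\mathbb{R}[x]^2$ (resp. $\sum\mathbb{R}[t]^2$) denotes the set of finite sums of squares of polynomials in $\mathbb{R}[x]=\mathbb{R}[x_1,\ldots,x_n]$ (resp. in $\mathbb{R}[t]$, $t$ a single variable). The same univariate polynomial $\varphi$ is used for all $i=1,\ldots,r$. *)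

(* Defs.v *)
From mathcomp Require Import all_boot all_order all_algebra.
From mathcomp Require Import all_classical all_reals all_analysis.
(* The notations of mpoly.v have precedence levels that clash with those of
   MathComp-Analysis, hence the restricted import and the notations below. *)
From mathcomp Require Import -(notations) mpoly.
Import Order.TTheory GRing.Theory Num.Theory.
Import numFieldNormedType.Exports.

Set Implicit Arguments.
Unset Strict Implicit.
Unset Printing Implicit Defensive.

Local Open Scope classical_set_scope.
Local Open Scope ring_scope.

Notation "{ 'mpoly' R [ n ] }" := (mpoly n R) (at level 0, R at level 2,
  format "{ 'mpoly'  R [ n ] }") : type_scope.
Notation "p .@[ v ]" := (meval v p) (at level 1, left associativity,
  format "p .@[ v ]") : ring_scope.

Definition sum_of_squares (A : pzSemiRingType) (p : A) : Prop :=
  exists s : seq A, p = \sum_(q <- s) q ^+ 2.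

(* For a row vector x, [x 0 : 'I_n -> R] is its family of coordinates. *)
Definition basic_closed_set (R : realType) (n r : nat)
    (g : 'I_r -> {mpoly R[n]}) : set 'rV[R]_n :=
  [set x | forall i : 'I_r, 0 <= (g i).@[x 0]].

Definition ball_poly (R : realType) (n : nat) (rho : R) : {mpoly R[n]} :=
  mpolyC n (rho ^+ 2) - \sum_(j < n) mpolyX R (mnm1 j) ^+ 2.

(* Main.v *)
(* Put [g_0 = rho^2 - |x|^2], so that [X] is cut out by [g_0, ..., g_r] inside the
   cube [|x_i| <= rho].  By compactness some [delta > 0] satisfies [f >= delta] at
   all points of the cube where every [g_i >= - delta].  On a given bounded
   interval a square [phi] can make [phi(t) t] tiny where [t >= 0], nonpositive where
   [t <= 0], and very negative where [t <= - delta]; then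
   [q = f - sum_(0 <= i <= r) phi(g_i) g_i] is bounded below by a positive constant
   on the whole cube.  Hence, for a large degree, all Bernstein coefficients of [q]
   are positive, i.e. [q] is a nonnegative combination of products of the
   polynomials [rho + x_i] and [rho - x_i].  These lie in the quadratic module of
   [g_0], which is stable under products because it has a single generator. *)
Require Import Defs.
From mathcomp Require Import all_boot all_order all_algebra.
From mathcomp Require Import all_classical all_reals all_analysis.
From mathcomp Require Import -(notations) mpoly.
From mathcomp Require Import ring lra.
Import Order.TTheory GRing.Theory Num.Theory.
Import numFieldNormedType.Exports.

Set Implicit Arguments.
Unset Strict Implicit.
Unset Printing Implicit Defensive.

Local Open Scope classical_set_scope.
Local Open Scope ring_scope.

(** * Sums of squares and quadratic modules with one generator *)

Lemma sum_of_squares0 (A : pzSemiRingType) : sum_of_squares (0 : A).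
Proof. by exists [::]; rewrite big_nil. Qed.

Lemma sum_of_squares_sqr (A : pzSemiRingType) (p : A) : sum_of_squares (p ^+ 2).
Proof. by exists [:: p]; rewrite big_seq1. Qed.

Lemma sum_of_squaresD (A : pzSemiRingType) (p q : A) :
  sum_of_squares p -> sum_of_squares q -> sum_of_squares (p + q).
Proof. by move=> [s ->] [t ->]; exists (s ++ t); rewrite big_cat. Qed.

Lemma sum_of_squaresM (A : comPzRingType) (p q : A) :
  sum_of_squares p -> sum_of_squares q -> sum_of_squares (p * q).
Proof.
move=> [s ->] [t ->]; exists [seq x * y | x <- s, y <- t].
rewrite big_allpairs_dep mulr_suml; apply: eq_bigr => x _.
by rewrite mulr_sumr; apply: eq_bigr => y _; rewrite exprMn.
Qed.

Lemma sum_of_squares_rmorph (A B : pzSemiRingType) (h : {rmorphism A -> B}) p :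
  sum_of_squares p -> sum_of_squares (h p).
Proof.
move=> [s ->]; exists (map h s); rewrite rmorph_sum big_map.
by apply: eq_bigr => x _; rewrite rmorphXn.
Qed.

Definition quadratic_module (A : comPzRingType) (g p : A) : Prop :=
  exists s0 s1, [/\ sum_of_squares s0, sum_of_squares s1 & p = s0 + s1 * g].

Section QuadraticModule.
Variables (A : comPzRingType) (g : A).
Local Notation T := (quadratic_module g).

Lemma quadratic_module_sos p : sum_of_squares p -> T p.
Proof.
by move=> hp; exists p, 0; split=> //; [exact: sum_of_squares0 | rewrite mul0r addr0].
Qed.

Lemma quadratic_module_gen : T g.
Proof.
exists 0, 1; split; [exact: sum_of_squares0| |by rewrite add0r mul1r].
by rewrite -(expr1n _ 2); apply: sum_of_squares_sqr.
Qed.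

Lemma quadratic_moduleD p q : T p -> T q -> T (p + q).
Proof.
move=> [s0 [s1 [h0 h1 ->]]] [t0 [t1 [k0 k1 ->]]].
exists (s0 + t0), (s1 + t1); split; [exact: sum_of_squaresD..|].
by rewrite mulrDl addrACA.
Qed.

(* [g ^+ 2] is a square, so the quadratic module of a single element is already
   a preordering. *)
Lemma quadratic_moduleM p q : T p -> T q -> T (p * q).
Proof.
move=> [s0 [s1 [h0 h1 ->]]] [t0 [t1 [k0 k1 ->]]].
exists (s0 * t0 + s1 * t1 * g ^+ 2), (s0 * t1 + s1 * t0); split; last by ring.
- apply: sum_of_squaresD; first exact: sum_of_squaresM.
  by apply: sum_of_squaresM; [exact: sum_of_squaresM | exact: sum_of_squares_sqr].
- by apply: sum_of_squaresD; apply: sum_of_squaresM.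
Qed.

Lemma quadratic_module0 : T 0.
Proof. exact/quadratic_module_sos/sum_of_squares0. Qed.

Lemma quadratic_module1 : T 1.
Proof.
by rewrite -(expr1n _ 2); apply/quadratic_module_sos/sum_of_squares_sqr.
Qed.

Lemma quadratic_module_sum (I : Type) (s : seq I) (P : pred I) (F : I -> A) :
  (forall i, P i -> T (F i)) -> T (\sum_(i <- s | P i) F i).
Proof. exact: (big_ind T quadratic_module0 quadratic_moduleD). Qed.

Lemma quadratic_module_prod (I : Type) (s : seq I) (P : pred I) (F : I -> A) :
  (forall i, P i -> T (F i)) -> T (\prod_(i <- s | P i) F i).
Proof. exact: (big_ind T quadratic_module1 quadratic_moduleM). Qed.

Lemma quadratic_moduleX p k : T p -> T (p ^+ k).
Proof.
move=> hp; elim: k => [|k ih]; first by rewrite expr0; apply: quadratic_module1.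
by rewrite exprS; apply: quadratic_moduleM.
Qed.

End QuadraticModule.

(** The scalar [c] acts as the square of the constant [sqrt c]. *)
Lemma quadratic_moduleZ (R : realType) (A : comAlgType R) (g p : A) (c : R) :
  0 <= c -> quadratic_module g p -> quadratic_module g (c *: p).
Proof.
move=> c0 hp; rewrite -mulr_algl; apply: quadratic_moduleM => //.
rewrite -(sqr_sqrtr c0) -[_%:A]/(in_alg A _) rmorphXn.
exact/quadratic_module_sos/sum_of_squares_sqr.
Qed.

(* [2 rho (rho - s x_i) = (rho^2 - |x|^2) + (rho - s x_i)^2 + sum_(j != i) x_j^2]
   when [s = 1] or [s = -1]. *)
Lemma quadratic_module_face (R : realType) (n : nat) (rho : R) (b : bool)
    (i : 'I_n) : 0 < rho ->
  quadratic_module (ball_poly n rho)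
    (mpolyC n rho - (-1) ^+ b *: mpolyX R (mnm1 i)).
Proof.
move=> rho0; set l := (_ - _).
have lE : (2 * rho) *: l = ball_poly n rho + l ^+ 2 +
     \sum_(j < n | j != i) mpolyX R (mnm1 j) ^+ 2.
  rewrite /ball_poly /l (bigD1 i) //= -!mul_mpolyC rmorphXn rmorphM rmorph_nat.
  by case: b {l}; rewrite !(expr0, expr1, rmorphN1, rmorph1); ring.
have -> : l = (2 * rho)^-1 *: ((2 * rho) *: l).
  by rewrite scalerA mulVf ?scale1r // mulf_neq0 ?gt_eqF.
rewrite lE.
apply: quadratic_moduleZ; first by rewrite invr_ge0 mulr_ge0 // ltW.
apply: quadratic_moduleD; first apply: quadratic_moduleD.
- exact: quadratic_module_gen.
- exact/quadratic_module_sos/sum_of_squares_sqr.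
apply: quadratic_module_sum => j _.
exact/quadratic_module_sos/sum_of_squares_sqr.
Qed.

(** * Bernstein coefficients *)

Lemma coef_exp1DZX (A : comNzRingType) (y : A) N k :
  ((1 + y *: 'X) ^+ N)`_k = y ^+ k *+ 'C(N, k).
Proof.
rewrite exprDn coef_sum.
under eq_bigr => i _ do
  rewrite expr1n mul1r exprZn coefMn coefZ coefXn mulr_natr -mulrnA mulnC mulrnA.
have [kN|Nk] := ltnP k N.+1; last first.
  rewrite bin_small // mulr0n big1 // => i _.
  by rewrite [k == _]eq_sym (ltn_eqF (leq_trans (ltn_ord i) Nk)) mulr0n.
rewrite (bigD1 (Ordinal kN)) //= eqxx mulr1n big1 ?addr0 // => i.
by rewrite -val_eqE /= eq_sym => /negbTE ->; rewrite mulr0n.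
Qed.

(** [y] ranges over any commutative ring because it is a variable at first and, after the change of
    coordinates, an affine form. *)
Definition bernstein (A : comNzRingType) N j (y : A) : A :=
  (y ^+ j * (1 - y) ^+ (N - j)) *+ 'C(N, j).

(* Compare the coefficients of [z ^+ k] in
   [(1 + y z) ^+ N = ((1 - y) + y (1 + z)) ^+ N]. *)
Lemma bernstein_moment (A : comNzRingType) (y : A) N k :
  y ^+ k *+ 'C(N, k) = \sum_(j < N.+1) bernstein N j y *+ 'C(j, k).
Proof.
rewrite -coef_exp1DZX.
have -> : 1 + y *: 'X = (1 - y)%:P + y%:P * (1 + 1 *: 'X) :> {poly A}.
  by rewrite scale1r polyCB -mul_polyC; ring.
rewrite exprDn coef_sum; apply: eq_bigr => j _.
rewrite exprMn -!rmorphXn mulrA -rmorphM coefMn coefCM coef_exp1DZX expr1n.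
by rewrite /bernstein mulr_natr -!mulrnA mulnC [_ ^+ j * _]mulrC.
Qed.

Lemma bin_ratioS (F : numFieldType) j N k : (k < N)%N ->
  'C(j, k.+1)%:R / 'C(N, k.+1)%:R =
  'C(j, k)%:R / 'C(N, k)%:R * ((j - k)%:R / (N - k)%:R) :> F.
Proof.
move=> kN.
(* This also holds for [m <= k]: both sides vanish, since [m - k] is truncated. *)
have E m : 'C(m, k.+1)%:R = (m - k)%:R * 'C(m, k)%:R / k.+1%:R :> F.
  by rewrite -natrM -mul_bin_left natrM mulrC mulKf ?pnatr_eq0.
have nz1 : (N - k)%:R != 0 :> F by rewrite pnatr_eq0 -lt0n subn_gt0.
have nz2 : 'C(N, k)%:R != 0 :> F by rewrite pnatr_eq0 -lt0n bin_gt0 ltnW.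
have nz3 : k.+1%:R != 0 :> F by rewrite pnatr_eq0.
by rewrite !E; field; rewrite nat1r nz3 nz2 nz1.
Qed.

(** These ratios are the Bernstein coefficients of [y ^+ k] in degree [N]. Each is a product of [k]
    factors [(j - i) / (N - i)], all close to [j / N] uniformly in [j]; hence the induction on
    [k]. *)
Lemma bin_ratio_cvg (R : realType) k (e : R) : 0 < e ->
  \forall N \near \oo, forall j, (j <= N)%N ->
    `|'C(j, k)%:R / 'C(N, k)%:R - (j%:R / N%:R) ^+ k| <= e.
Proof.
elim: k e => [|k ih] e e0.
  by apply: nearW => N j _; rewrite !bin0 expr0 divr1 subrr normr0 ltW.
have e20 : 0 < e / 2 by rewrite divr_gt0.
near=> N => j jN.
have kN : (k < N)%N by near: N; exact: nbhs_infty_ge.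
have Nk : k%:R / N%:R <= e / 2.
  rewrite ler_pdivrMr ?ltr0n ?(leq_ltn_trans _ kN) // mulrC -ler_pdivrMr //.
  by near: N; exact: nbhs_infty_ger.
have N0 : 0 < N%:R :> R by rewrite ltr0n (leq_ltn_trans _ kN).
have IH : `|'C(j, k)%:R / 'C(N, k)%:R - (j%:R / N%:R) ^+ k| <= e / 2.
  by move: j jN; near: N; apply: ih.
rewrite bin_ratioS // exprSr.
set a := 'C(j, k)%:R / _ in IH *; set s := (j - k)%:R / _.
set t := j%:R / _ in IH *.
have -> : a * s - t ^+ k * t = a * (s - t) + (a - t ^+ k) * t by ring.
have a01 : 0 <= a <= 1.
  rewrite divr_ge0 //= ler_pdivrMr ?ltr0n ?bin_gt0 1?ltnW //.
  by rewrite mul1r ler_nat leq_bin2l.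
have t01 : 0 <= t <= 1 by rewrite divr_ge0 //= ler_pdivrMr // mul1r ler_nat.
have st : `|s - t| <= k%:R / N%:R.
  (* The exact formula for [t - s] below is for [k <= j]; otherwise truncation makes [s = 0], and
     [t < k / N]. *)
  have [kj|jk] := leqP k j; last first.
    rewrite /s (eqP (ltnW jk)) mul0r sub0r normrN ger0_norm; last by case/andP: t01.
    by rewrite ler_pM2r ?invr_gt0 // ler_nat ltnW.
  have Nk0 : 0 < N%:R - k%:R :> R by rewrite subr_gt0 ltr_nat.
  rewrite /s /t !natrB ?(ltnW kN) // -normrN opprB.
  have -> : j%:R / N%:R - (j%:R - k%:R) / (N%:R - k%:R) =
      k%:R / N%:R * ((N%:R - j%:R) / (N%:R - k%:R)) :> R.
    by field; rewrite !gt_eqF.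
  set q := (N%:R - j%:R) / (N%:R - k%:R).
  have q01 : 0 <= q <= 1.
    rewrite divr_ge0 ?subr_ge0 ?ler_nat ?(ltnW kN) //= ler_pdivrMr //.
    by rewrite mul1r lerD2l lerN2 ler_nat.
  case/andP: q01 => q0 q1; rewrite ger0_norm; last by apply: mulr_ge0 => //; apply: divr_ge0.
  by rewrite ler_piMr // divr_ge0.
case/andP: a01 => a0 a1; case/andP: t01 => t0 t1.
rewrite (le_trans (ler_normD _ _)) // (normrM a) (normrM _ t) (ger0_norm a0) (ger0_norm t0).
rewrite [leRHS](splitr e) lerD //.
- by apply: le_trans (le_trans st Nk); rewrite ler_piMl.
- by apply: le_trans IH; rewrite ler_piMr.
Unshelve. all: by end_near.
Qed.

(** Telescoping: the factors are swapped one at a time, the remaining ones having norm at most 1. *)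
Lemma ler_dist_prod (R : realDomainType) (I : Type) (s : seq I) (a b : I -> R) :
  (forall i, `|a i| <= 1) -> (forall i, `|b i| <= 1) ->
  `|\prod_(i <- s) a i - \prod_(i <- s) b i| <= \sum_(i <- s) `|a i - b i|.
Proof.
move=> a1 b1; elim: s => [|i s ih]; first by rewrite !big_nil subrr normr0.
rewrite !big_cons; set p := \prod_(i <- s) a i in ih *; set q := (X in _ - _ * X).
have -> : a i * p - b i * q = (a i - b i) * q + a i * (p - q) by rewrite /q; ring.
have q1 : `|q| <= 1 by rewrite normr_prod prodr_ile1 // => j _; rewrite normr_ge0 b1.
rewrite (le_trans (ler_normD _ _)) // !normrM lerD ?ler_piMr //.
by apply: le_trans ih; rewrite ler_piMl.
Qed.

Section Bernstein.
Variables (R : realType) (n : nat).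
Local Notation X i := (mpolyX R (mnm1 i)).

Definition mbernstein N (J : {ffun 'I_n -> 'I_N.+1}) : {mpoly R[n]} :=
  \prod_(i < n) bernstein N (J i) (X i).

Definition grid N (J : {ffun 'I_n -> 'I_N.+1}) : 'I_n -> R :=
  fun i => (J i)%:R / N%:R.

Lemma grid_itv N (J : {ffun 'I_n -> 'I_N.+1}) i : 0 <= grid J i <= 1.
Proof.
(* For [N = 0] the division by zero returns 0, which still lies in the interval. *)
rewrite /grid divr_ge0 //=; case: N J => [|N] J; first by rewrite invr0 mulr0.
by rewrite ler_pdivrMr ?ltr0n // mul1r ler_nat -ltnS.
Qed.

(** [b] is left existential: its closeness to the grid values is all that linear combinations and
    the positivity argument use. *)
Definition bernstein_approx (p : {mpoly R[n]}) (e : R) N :=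
  exists b : {ffun 'I_n -> 'I_N.+1} -> R,
    p = \sum_J b J *: mbernstein J /\ forall J, `|b J - p.@[grid J]| <= e.

Lemma bernstein_approx0 e N : 0 <= e -> bernstein_approx 0 e N.
Proof.
move=> e0; exists (fun=> 0); split=> [|J]; last by rewrite meval0 subrr normr0.
by rewrite big1 // => J _; rewrite scale0r.
Qed.

Lemma bernstein_approxZD p q c e1 e2 N :
  bernstein_approx p e1 N -> bernstein_approx q e2 N ->
  bernstein_approx (c *: p + q) (`|c| * e1 + e2) N.
Proof.
move=> [b [pE hb]] [d [qE hd]]; exists (fun J => c * b J + d J); split.
  rewrite {1}pE {1}qE scaler_sumr -big_split; apply: eq_bigr => J _.
  by rewrite scalerDl scalerA.
move=> J; rewrite mevalD mevalZ opprD addrACA -mulrBr.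
rewrite (le_trans (ler_normD _ _)) // normrM lerD //.
exact: ler_wpM2l.
Qed.

(** The coefficients of a monomial are products of the one-variable ones, so the errors of the [n]
    factors add up. *)
Lemma bernstein_approxX (m : multinom n) (e : R) : 0 < e ->
  \forall N \near \oo, bernstein_approx (mpolyX R m) e N.
Proof.
(* [n.+1] keeps the divisor nonzero for [n = 0]; the [n] errors still sum to at most [e]. *)
move=> e0; have e'0 : 0 < e / n.+1%:R by rewrite divr_gt0.
near=> N.
have Nm : forall i : 'I_n, (m i <= N)%N.
  by near: N; apply: filter_forall => i; exact: nbhs_infty_ge.
have Nr : forall (i : 'I_n) j, (j <= N)%N ->
    `|'C(j, m i)%:R / 'C(N, m i)%:R - (j%:R / N%:R) ^+ m i| <= e / n.+1%:R.
  by near: N; apply: filter_forall => i; exact: bin_ratio_cvg.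
exists (fun J : {ffun 'I_n -> 'I_N.+1} => \prod_i ('C(J i, m i)%:R / 'C(N, m i)%:R)); split.
  rewrite mpolyXE_id; under [RHS]eq_bigr => J _.
    rewrite -[_ *: _]mul_mpolyC rmorph_prod -big_split /=; over.
  (* Factoring the sum over [J] reduces the identity to one variable, where it is [bernstein_moment]
     divided by ['C(N, m i)]. *)
  rewrite -(bigA_distr_bigA (fun (i : 'I_n) (j : 'I_N.+1) =>
    mpolyC n ('C(j, m i)%:R / 'C(N, m i)%:R) * bernstein N j (X i))).
  apply: eq_bigr => i _.
  have nz : 'C(N, m i)%:R != 0 :> R by rewrite pnatr_eq0 -lt0n bin_gt0.
  apply: (scalerI nz); rewrite scaler_nat bernstein_moment scaler_sumr.
  apply: eq_bigr => j _.
  by rewrite mul_mpolyC scalerA mulrCA mulfV // mulr1 scaler_nat.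
move=> J; rewrite mevalX (le_trans (ler_dist_prod _ _ _)) //.
- move=> i; rewrite ger0_norm ?divr_ge0 // ler_pdivrMr ?ltr0n ?bin_gt0 //.
  by rewrite mul1r ler_nat leq_bin2l // -ltnS.
- move=> i; case/andP: (grid_itv J i) => ? ?.
  by rewrite normrX exprn_ile1 // ger0_norm.
- apply: (@le_trans _ _ (\sum_(i < n) e / n.+1%:R)).
    by apply: ler_sum => i _; rewrite Nr // -ltnS.
  rewrite sumr_const card_ord -[leLHS]mulr_natr -mulrA ler_piMr ?(ltW e0) //.
  by rewrite mulrC ler_pdivrMr ?ltr0n // mul1r ler_nat.
Unshelve. all: by end_near.
Qed.

Lemma bernstein_approx_cvg (p : {mpoly R[n]}) (e : R) : 0 < e ->
  \forall N \near \oo, bernstein_approx p e N.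
Proof.
elim/mpolyind: p e => [|c m p _ c0 ih] e e0.
  by apply: nearW => N; apply/bernstein_approx0/ltW.
have c0' : `|c| != 0 by rewrite normr_eq0.
near=> N.
have -> : e = `|c| * (e / 2 / `|c|) + e / 2 by field.
apply: bernstein_approxZD; near: N.
- by apply: bernstein_approxX; rewrite !divr_gt0 // normr_gt0.
- by apply: ih; rewrite divr_gt0.
Unshelve. all: by end_near.
Qed.

(** Coefficients within [e] of values that are at least [e] cannot be negative. *)
Lemma bernstein_pos (p : {mpoly R[n]}) (e : R) : 0 < e ->
  (forall x : 'I_n -> R, (forall i, 0 <= x i <= 1) -> e <= p.@[x]) ->
  exists N (b : {ffun 'I_n -> 'I_N.+1} -> R),
    (forall J, 0 <= b J) /\ p = \sum_J b J *: mbernstein J.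
Proof.
move=> e0 pe; have [N _ /(_ N (leqnn N)) [b [pE bE]]] := bernstein_approx_cvg p e0.
exists N, b; split=> // J; have := bE J; rewrite ler_distl => /andP[+ _].
apply: le_trans; rewrite subr_ge0; apply: pe => i; exact: grid_itv.
Qed.

End Bernstein.

(** * Penalty polynomial and compactness *)

Lemma bernoulli_ineq (R : realDomainType) (u : R) k :
  0 <= u -> 1 + k%:R * u <= (1 + u) ^+ k.
Proof.
move=> u0; elim: k => [|k ih]; first by rewrite mul0r addr0 expr0.
rewrite exprS; apply: (@le_trans _ _ ((1 + u) * (1 + k%:R * u))).
  rewrite -natr1; have : 0 <= k%:R * (u * u) by rewrite !mulr_ge0.
  lra.
by rewrite ler_wpM2l // addr_ge0.
Qed.

(* [phi = (2 k eps / M) (1 - t / M) ^ (2 k)] with [k] large: for [u = t / M] in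
   [[0, 1]], Bernoulli's inequality gives
   [2 k u (1 - u) ^ (2 k) <= ((1 + u) (1 - u)) ^ (2 k) <= 1]. *)
Lemma sos_penalty (R : realType) (eps delta M C : R) :
  0 < eps -> 0 < delta -> 0 < M ->
  exists phi : {poly R}, sum_of_squares phi /\
    forall t, - M <= t <= M ->
      phi.[t] * t <= eps /\ (t <= - delta -> phi.[t] * t <= - C).
Proof.
move=> e0 d0 M0.
(* This [k] makes [c * delta >= C] for the leading factor [c = 2 k eps / M], as required where
   [t <= - delta]. *)
have [k _ /(_ k (leqnn k)) kC] := nbhs_infty_ger (C * M / (2 * eps * delta)).
have {}kC : C <= (k + k)%:R * eps / M * delta.
  have -> : (k + k)%:R * eps / M * delta = k%:R * (2 * eps * delta) / M.
    by rewrite natrD; ring.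
  by rewrite ler_pdivlMr // -ler_pdivrMr ?mulr_gt0.
pose c := (k + k)%:R * eps / M.
have c0 : 0 <= c by rewrite divr_ge0 // ?mulr_ge0 // ltW.
exists ((Num.sqrt c *: (1 - M^-1 *: 'X) ^+ k) ^+ 2); split.
  exact: sum_of_squares_sqr.
move=> t tM; rewrite horner_exp hornerZ horner_exp !hornerE exprMn sqr_sqrtr //.
rewrite -exprM muln2 -addnn; set d := (k + k)%N in c c0 kC *.
have [t0|t0] := leP 0 t.
  split=> [|tl]; last by lra.
  set u := M^-1 * t.
  have u0 : 0 <= u by rewrite mulr_ge0 // invr_ge0 ltW.
  have u1 : u <= 1 by rewrite /u mulrC ler_pdivrMr // mul1r; case/andP: tM.
  have -> : c * (1 - u) ^+ d * t = eps * (d%:R * u * (1 - u) ^+ d).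
    by rewrite /c /u; ring.
  rewrite ler_piMr ?(ltW e0) //.
  apply: (@le_trans _ _ ((1 + u) ^+ d * (1 - u) ^+ d)).
    rewrite ler_wpM2r ?exprn_ge0 ?subr_ge0 //.
    by apply: le_trans (bernoulli_ineq d u0); rewrite lerDr.
  by rewrite -exprMn exprn_ile1 //; nra.
(* For [t < 0] the power is at least 1, so [phi.[t] * t <= c * t]. *)
have p1 : 1 <= (1 - M^-1 * t) ^+ d.
  rewrite exprn_ege1 // lerDl -mulrN mulr_ge0 ?invr_ge0 ?(ltW M0) //.
  by rewrite oppr_ge0 ltW.
set w := _ ^+ d in p1 *.
split=> [|td].
  apply: le_trans (ltW e0); rewrite -mulrA mulr_ge0_le0 //.
  by rewrite mulr_ge0_le0 ?(ltW t0) // (le_trans _ p1).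
rewrite -[leLHS]opprK lerN2 -mulrN; apply: le_trans kC _; rewrite -/c.
apply: ler_pM; [by []|exact: ltW|by rewrite ler_peMr|by rewrite lerNr].
Qed.

(** For nonempty [K], the function [h] below, twice the sum of the positive part of [f] and the
    negative parts of the [g i], is positive on [K], so it has a positive minimum there. A point
    with all [g i >= - delta] and [f < delta] would have [h] too small. *)
Lemma compact_pos_perturb (R : realType) (T : topologicalType) (K : set T)
    (I : finType) (f : T -> R) (g : I -> T -> R) :
  compact K -> continuous f -> (forall i, continuous (g i)) ->
  (forall x, K x -> (forall i, 0 <= g i x) -> 0 < f x) ->
  exists2 delta, 0 < delta &
    forall x, K x -> (forall i, - delta <= g i x) -> delta <= f x.
Proof.
move=> cK cf cg pos.
have [->|K0] := eqVneq K set0; first by exists 1.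
pose h x := `|f x| + f x + \sum_i (`|g i x| - g i x).
have ch : continuous h.
  move=> x; apply: cvgD; first by apply: cvgD; [apply: cvg_norm|]; exact: cf.
  apply: (cvg_big add_continuous) => i _; apply: cvgB; [apply: cvg_norm|]; exact: cg.
have h0 x : K x -> 0 < h x.
  move=> Kx; have af y : 0 <= `|y| + y :> R.
    by rewrite -lerBlDr sub0r -normrN ler_norm.
  have ag i : true -> 0 <= `|g i x| - g i x by rewrite subr_ge0 ler_norm.
  have [gx|] := pselect (forall i, 0 <= g i x).
    have fx := pos x Kx gx.
    by apply: ltr_pwDl; [rewrite addr_gt0 // normr_gt0 gt_eqF|exact: sumr_ge0].
  move=> /existsNP[i /negP]; rewrite -ltNge => gi; apply: ltr_wpDl => //.
  rewrite (bigD1 i) //=; apply: ltr_pwDl; last by apply: sumr_ge0 => *; apply: ag.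
  by rewrite ltr0_norm //; lra.
have /set0P K0' := K0.
have [x0 x0K hmin] := compact_EVT_min K0' cK (continuous_subspaceT ch).
have e0 : 0 < h x0 by apply: h0; rewrite inE in x0K.
(* Chosen so that [2 * delta * #|I|.+1] is the minimum of [h]. *)
pose delta := h x0 / (2 * #|I|.+1%:R).
have d0 : 0 < delta by rewrite divr_gt0.
exists delta => // x Kx gx; rewrite leNgt; apply/negP => fx.
have hx : h x < 2 * delta + \sum_(i : I) 2 * delta.
  apply: ltr_leD; first by case: (ger0P (f x)) => _; lra.
  by apply: ler_sum => i _; have := gx i; case: (ger0P (g i x)) => _; lra.
have : h x < h x0.
  apply: lt_le_trans hx _; rewrite sumr_const -[2 * delta in leLHS]mulr1n -mulrnDr.
  rewrite add1n -[leLHS]mulr_natr /delta; set c := #|I|.+1%:R.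
  have c0 : c != 0 by rewrite pnatr_eq0.
  by have -> : 2 * (h x0 / (2 * c)) * c = h x0 by field.
by rewrite ltNge hmin // inE.
Qed.

Lemma meval_continuous (R : realType) n (p : {mpoly R[n]}) :
  continuous (fun x : 'rV[R]_n => p.@[x 0]).
Proof.
elim/mpolyind: p => [|c m p _ _ ih].
  under eq_fun do rewrite meval0.
  exact: cst_continuous.
under eq_fun do rewrite mevalD mevalZ mevalX.
have cX (i : 'I_n) : continuous (fun x : 'rV[R]_n => x 0 i ^+ m i).
  move=> x; apply: (@continuous_comp _ _ _ (fun x : 'rV[R]_n => x 0 i) (fun y => y ^+ m i)).
    exact: coord_continuous.
  exact: exprn_continuous.
move=> x; have FF := nbhs_filter x.
apply: (cvgD (FF := FF)); last exact: ih.
apply: (cvgM (FF := FF)); first exact: cvg_cst.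
by apply: (cvg_big mul_continuous) => i _; exact: cX.
Qed.

Lemma meval_bounded (R : realType) n (p : {mpoly R[n]}) (K : set 'rV[R]_n) :
  compact K -> exists2 M, 0 < M & forall x, K x -> `|p.@[x 0]| <= M.
Proof.
move=> cK; have [->|/set0P K0] := eqVneq K set0; first by exists 1.
have cp : continuous (fun x : 'rV[R]_n => `|p.@[x 0]|).
  by move=> x; exact: (cvg_norm (FF := nbhs_filter x) (@meval_continuous R n p x)).
have [x0 _ pmax] := compact_EVT_max K0 cK (continuous_subspaceT cp).
exists (1 + `|p.@[x0 0]|); first by rewrite ltr_pwDl.
by move=> x Kx; rewrite (le_trans (pmax x _)) ?inE // lerDr.
Qed.

(** * Polynomials positive on a cube *)

Lemma meval_horner_alg (R : realType) n (v : 'I_n -> R) (g : {mpoly R[n]})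
    (phi : {poly R}) : (horner_alg g phi).@[v] = phi.[g.@[v]].
Proof.
elim/poly_ind: phi => [|p c ih]; first by rewrite rmorph0 meval0 horner0.
rewrite rmorphD rmorphM /= horner_algX horner_algC mevalD mevalM ih alg_mpolyC mevalC.
by rewrite hornerMXaddC.
Qed.

(** Lets the affine change of coordinates between the two cubes be undone. *)
Lemma comp_mpoly_comp (R : comNzRingType) n k l (p : {mpoly R[n]})
    (lp : n.-tuple {mpoly R[k]}) (lq : k.-tuple {mpoly R[l]}) :
  comp_mpoly lq (comp_mpoly lp p) =
  comp_mpoly [tuple comp_mpoly lq (tnth lp i) | i < n] p.
Proof.
rewrite [comp_mpoly lp p]comp_mpolyE [RHS]comp_mpolyE raddf_sum /=.
apply: eq_bigr => m _; rewrite comp_mpolyZ rmorph_prod; congr (_ *: _).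
by apply: eq_bigr => i _; rewrite rmorphXn tnth_mktuple.
Qed.

Lemma rmorph_bernstein (A B : comNzRingType) (h : {rmorphism A -> B}) N j y :
  h (bernstein N j y) = bernstein N j (h y).
Proof. by rewrite /bernstein rmorphMn rmorphM !rmorphXn rmorphB rmorph1. Qed.

Lemma quadratic_module_bernstein (R : realType) (A : comAlgType R) (g y : A) N j :
  quadratic_module g y -> quadratic_module g (1 - y) ->
  quadratic_module g (bernstein N j y).
Proof.
move=> hy h1y; rewrite /bernstein -(@scaler_nat R); apply: quadratic_moduleZ => //.
by apply: quadratic_moduleM; apply: quadratic_moduleX.
Qed.

Definition cube (R : realType) n (rho : R) : set 'rV[R]_n :=
  [set x | forall i, - rho <= x 0 i <= rho].
Arguments cube {R} n rho _.

Lemma compact_cube (R : realType) n (rho : R) : compact (cube n rho).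
Proof.
have := @rV_compact R n (fun=> `[- rho, rho]%classic) (fun=> @segment_compact R _ _).
by congr compact; apply/seteqP; split => x hx i; have := hx i; rewrite /= in_itv.
Qed.

(** An affine substitution reduces to [[0, 1]^n], where [bernstein_pos] applies. Substituting back,
    [y] and [1 - y] become positive multiples of [rho + x_i] and [rho - x_i], so every Bernstein
    product lies in the module. *)
Lemma quadratic_module_pos_cube (R : realType) n (rho e : R) (q : {mpoly R[n]}) :
  0 < rho -> 0 < e -> (forall x, cube n rho x -> e <= q.@[x 0]) ->
  quadratic_module (ball_poly n rho) q.
Proof.
move=> rho0 e0 qe.
have r0 : 2 * rho != 0 by rewrite mulf_neq0 ?gt_eqF.
pose X i : {mpoly R[n]} := mpolyX R (mnm1 i).
(* [Z] maps [[0, 1]^n] onto the cube, and [Y] is its inverse. *)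
pose Z := [tuple (2 * rho) *: X i - mpolyC n rho | i < n].
pose Y := [tuple (2 * rho)^-1 *: (mpolyC n rho + X i) | i < n].
have [N [b [b0 pE]]] : exists N (b : {ffun 'I_n -> 'I_N.+1} -> R),
    (forall J, 0 <= b J) /\ comp_mpoly Z q = \sum_J b J *: mbernstein R J.
  apply: (bernstein_pos e0) => x x01; rewrite comp_mpoly_meval.
  set v := (fun i => _).
  have -> : v = (\row_i v i) 0 by apply/funext => i; rewrite mxE.
  apply: qe => i; rewrite mxE /v tnth_mktuple mevalB mevalZ mevalXU mevalC.
  by have /andP[x0 x1] := x01 i; nra.
have -> : q = comp_mpoly Y (comp_mpoly Z q).
  rewrite comp_mpoly_comp -[LHS]comp_mpoly_id; congr (comp_mpoly _ q).
  apply: eq_from_tnth => i; rewrite !tnth_mktuple comp_mpolyB comp_mpolyZ comp_mpolyC.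
  by rewrite comp_mpolyXU -tnth_nth tnth_mktuple scalerA mulfV // scale1r addrC addKr.
rewrite pE raddf_sum /=; apply: quadratic_module_sum => J _ /=.
rewrite comp_mpolyZ; apply: quadratic_moduleZ => //.
rewrite rmorph_prod; apply: quadratic_module_prod => i _.
have faceP (c : bool) : quadratic_module (ball_poly n rho)
   ((2 * rho)^-1 *: (mpolyC n rho - (-1) ^+ c *: X i)).
  apply: quadratic_moduleZ; last exact: quadratic_module_face.
  by rewrite invr_ge0 mulr_ge0 // ltW.
rewrite /= rmorph_bernstein /= comp_mpolyXU -tnth_nth tnth_mktuple.
apply: quadratic_module_bernstein.
  by have := faceP true; rewrite /= expr1 scaleN1r opprK.
have := faceP false; rewrite /= expr0 scale1r; congr quadratic_module.
have -> : 1 = (2 * rho)^-1 *: (2 *: mpolyC n rho) :> {mpoly R[n]}.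
  by rewrite scalerA -alg_mpolyC scalerA -mulrA mulVf // scale1r.
rewrite -scalerBr scaler_nat; congr (_ *: _); ring.
Qed.

Theorem corollary2p1 (R : realType) (n r : nat) (g : 'I_r -> {mpoly R[n]})
    (rho : R) (f : {mpoly R[n]}) :
  compact (basic_closed_set g) ->
  0 < rho ->
  (forall x : 'rV[R]_n, basic_closed_set g x ->
    0 <= (ball_poly n rho).@[x 0]) ->
  (forall x : 'rV[R]_n, basic_closed_set g x -> 0 < f.@[x 0]) ->
  exists (sigma0 sigma1 : {mpoly R[n]}) (phi : {poly R}),
    [/\ sum_of_squares sigma0, sum_of_squares sigma1, sum_of_squares phi &
      f = sigma0 + sigma1 * ball_poly n rho
          + \sum_(i < r) horner_alg (g i) phi * g i].
Proof.
move=> _ rho0 _ fpos.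
(* The ball polynomial takes index 0, so that it is penalized like the other constraints. *)
pose g' (i : 'I_r.+1) := oapp g (ball_poly n rho) (unlift ord0 i).
have cK := @compact_cube R n rho.
have [delta d0 hd] : exists2 delta, 0 < delta & forall x, cube n rho x ->
    (forall i, - delta <= (g' i).@[x 0]) -> delta <= f.@[x 0].
  apply: compact_pos_perturb => //; first exact: meval_continuous.
    by move=> i; exact: meval_continuous.
  move=> x _ gx; apply: fpos => i.
  by have := gx (lift ord0 i); rewrite /g' liftK.
have [Mf Mf0 hMf] := meval_bounded f cK.
(* The bound is common to all [g' i] because the same [phi] serves each of them. *)
have [M M0 hM] : exists2 M, 0 < M & forall i x, cube n rho x -> `|(g' i).@[x 0]| <= M.
  have /fin_all_exists2[m m0 hm] i := meval_bounded (g' i) cK.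
  exists (1 + \sum_i m i); first by rewrite ltr_pwDl // sumr_ge0 // => i _; exact: ltW.
  move=> i x Kx; apply: le_trans (hm i x Kx) _; rewrite (bigD1 i) //=.
  have : 0 <= \sum_(j | j != i) m j by apply: sumr_ge0 => j _; exact: ltW.
  by lra.
(* The [r.+1] penalty terms then total at most [delta / 2]. *)
pose eps := delta / (2 * r.+1%:R).
have eps0 : 0 < eps by rewrite divr_gt0.
(* Where some [g' i <= - delta], its term is at most [- (Mf + delta)] and the others sum to at most
   [delta / 2]; with [f >= - Mf] this leaves [q >= delta / 2]. *)
have [phi [phi_sos hphi]] := sos_penalty (Mf + delta) eps0 d0 M0.
pose q := f - \sum_i horner_alg (g' i) phi * g' i.
have epsE : eps *+ r.+1 = delta / 2.
  by rewrite -mulr_natr /eps; field; rewrite nat1r pnatr_eq0.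
have [] : quadratic_module (ball_poly n rho) q.
  apply: (@quadratic_module_pos_cube _ _ _ (delta / 2)); rewrite ?divr_gt0 // => x Kx.
  rewrite mevalB (raddf_sum (meval (x 0))) /=.
  have bnd i : (horner_alg (g' i) phi * g' i).@[x 0] <= eps /\
      ((g' i).@[x 0] <= - delta ->
       (horner_alg (g' i) phi * g' i).@[x 0] <= - (Mf + delta)).
    by rewrite mevalM meval_horner_alg; apply: hphi; rewrite -ler_norml hM.
  (* In the first case [f >= delta] already outweighs the penalties. *)
  have [gx|] := pselect (forall i, - delta <= (g' i).@[x 0]).
    have := hd x Kx gx.
    have : \sum_i (horner_alg (g' i) phi * g' i).@[x 0] <= eps *+ r.+1.
      rewrite -[r.+1 in leRHS]card_ord -sumr_const; apply: ler_sum => i _.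
      by case: (bnd i).
    by rewrite epsE; lra.
  move=> /existsNP[i /negP]; rewrite -ltNge => /ltW gi.
  have := hMf x Kx; rewrite ler_norml => /andP[fx _].
  have [_ /(_ gi) gi'] := bnd i.
  rewrite (bigD1 i) //=.
  have : \sum_(j | j != i) (horner_alg (g' j) phi * g' j).@[x 0] <= eps *+ r.+1.
    rewrite -[r.+1 in leRHS]card_ord -sumr_const [leRHS](bigD1 i) //=.
    apply: ler_wpDl; first exact: ltW.
    by apply: ler_sum => j _; case: (bnd j).
  by rewrite epsE; lra.
move=> s0 [s1 [s0_sos s1_sos qE]].
(* The index 0 term [phi(g_0) g_0] is absorbed into [sigma1]; [phi(g_0)] is a sum of squares as the
   image of [phi] under a ring morphism. *)
exists s0, (s1 + horner_alg (ball_poly n rho) phi), phi; split => //.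
  by apply: sum_of_squaresD => //; exact: sum_of_squares_rmorph.
have -> : f = q + \sum_i horner_alg (g' i) phi * g' i by rewrite subrK.
rewrite qE big_ord_recl mulrDl /g' unlift_none /= !addrA; congr (_ + _).
by apply: eq_bigr => i _; rewrite liftK.
Qed.
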